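(* Let $G$ be an oriented hypergraph with $n$ vertices, and let $e$ be an edge of $G$. Then $$\lambda_{k+1}(L(G))\le\lambda_k(L(G\backslash e))\le\lambda_k(L(G))\quad\text{for all } k\in\{1,\dots,n-1\}.$$
   Context: An oriented hypergraph $G=(H,\sigma)$ consists of a finite hypergraph $H=(V,E,\mathcal{I})$ with vertex set $V=\{v_1,\dots,v_n\}$, a finite set $E$ of edges, each edge a (possibly empty) subset of $V$, and incidence set $\mathcal{I}$, together with an incidence orientation $\sigma:\mathcal{I}\to\{+1,-1\}$. Throughout, hypergraphs are simple: $(v,e)\in\mathcal{I}$ if and only if $v\in e$, each such pair occurring once. The degree $d_i$ of $v_i$ is the number of incidences containing $v_i$. For distinct $v_i,v_j\in e$, $\mathrm{sgn}_e(v_i,v_j)=-\sigma(v_i,e)\sigma(v_j,e)$. The adjacency matrix $A(G)=(a_{ij})$ has $a_{ij}=\sum_{e\in E:\, v_i,v_j\in e}\mathrm{sgn}_e(v_i,v_j)$ for $i\neq j$ and $a_{ii}=0$; $D(G)=\mathrm{diag}(d_1,\dots,d_n)$; the Laplacian is $L(G)=D(G)-A(G)$. The weak edge-deletion $G\backslash e$ has vertex set $V$, edge set $E\setminus\{e\}$, all incidences containing $e$ removed, and the remaining incidences keeping their orientation. Eigenvalues of a real symmetric $N\times N$ matrix $M$ are ordered $\lambda_N(M)\le\cdots\le\lambda_1(M)$. *)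

(* Defs.v *)
From mathcomp Require Import all_boot all_order all_algebra.
From mathcomp Require Import polyrcf.
Set Implicit Arguments.
Unset Strict Implicit.
Unset Printing Implicit Defensive.
Import Order.TTheory GRing.Theory Num.Theory.
Local Open Scope ring_scope.

(* In a simple hypergraph on the vertices 'I_n, the edge set E (a finite set
   of subsets of the vertex set) determines the incidence set. *)
Definition incidences_of (n : nat) (E : {set {set 'I_n}}) :
    {set 'I_n * {set 'I_n}} :=
  [set p | (p.2 \in E) && (p.1 \in p.2)].

(* The orientation is a total function, constrained to +1 or -1 on the
   incidences; its values elsewhere are meaningless and are never used. *)
Record oriented_hypergraph (n : nat) := OrientedHypergraph {
  edges : {set {set 'I_n}};
  orient : 'I_n -> {set 'I_n} -> int;
  orient_pm1 : forall (v : 'I_n) (e : {set 'I_n}),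
    (v, e) \in incidences_of edges -> orient v e = 1 \/ orient v e = -1
}.

Definition incidences (n : nat) (G : oriented_hypergraph n) :
    {set 'I_n * {set 'I_n}} :=
  incidences_of (edges G).

Definition hdegree (n : nat) (G : oriented_hypergraph n) (v : 'I_n) : nat :=
  #|[set p in incidences G | p.1 == v]|.

Definition hsgn (n : nat) (G : oriented_hypergraph n) (e : {set 'I_n})
    (v w : 'I_n) : int :=
  - orient G v e * orient G w e.

Definition adjacency (R : pzRingType) (n : nat) (G : oriented_hypergraph n) :
    'M[R]_n :=
  \matrix_(i, j)
    if i == j then 0
    else (\sum_(e in edges G | (i \in e) && (j \in e)) hsgn G e i j)%:~R.

Definition degree_mx (R : pzRingType) (n : nat) (G : oriented_hypergraph n) :
    'M[R]_n :=
  diag_mx (\row_i (hdegree G i)%:R).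

Definition laplacian (R : pzRingType) (n : nat) (G : oriented_hypergraph n) :
    'M[R]_n :=
  degree_mx R G - adjacency R G.

Lemma edge_deletion_pm1 (n : nat) (G : oriented_hypergraph n)
    (e : {set 'I_n}) (v : 'I_n) (f : {set 'I_n}) :
  (v, f) \in incidences_of (edges G :\ e) ->
  orient G v f = 1 \/ orient G v f = -1.
Proof.
rewrite !inE /= => /andP[/andP[_ fE] vf]; apply: orient_pm1.
by rewrite inE /= fE vf.
Qed.

Definition edge_deletion (n : nat) (G : oriented_hypergraph n)
    (e : {set 'I_n}) : oriented_hypergraph n :=
  OrientedHypergraph (@edge_deletion_pm1 n G e).

(* The eigenvalues of M lying in R, with algebraic multiplicity, in
   nonincreasing order.  When M is symmetric, all n of them are in R. *)
Definition eigenvalues (R : rcfType) (n : nat) (M : 'M[R]_n) : seq R :=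
  sort (fun x y => y <= x)
    (flatten [seq nseq (mup x (char_poly M)) x | x <- rootsR (char_poly M)]).

(* lambda k M is the k-th largest eigenvalue, counted from k = 1. *)
Definition lambda (R : rcfType) (k : nat) (n : nat) (M : 'M[R]_n) : R :=
  nth 0 (eigenvalues M) k.-1.

(* Main.v *)
(* If w is the column of signed incidences of e, then L(G) = L(G \ e) + w w^T,
   so the two quadratic forms compare everywhere and agree on the hyperplane
   orthogonal to w.  Counting the eigenvalues >= c of two Hermitian matrices
   whose forms compare on a subspace of codimension m (here 0 or 1) gives both
   inequalities.  The spectral theorem is applied over R[i]. *)
Require Import Defs.
From mathcomp Require Import all_boot all_order all_algebra.
From mathcomp Require Import reals.
From mathcomp Require Import polyrcf complex.
Import Order.TTheory GRing.Theory Num.Theory.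
Local Open Scope ring_scope.
Local Open Scope sesquilinear_scope.
Local Open Scope complex_scope.

(** * Sorted sequences and roots of characteristic polynomials *)

(** In a nonincreasing list the entries [>= c] form a prefix. The count ignores order, so positions
    in two spectra can be compared through cardinalities. *)
Lemma nth_sort_ge (R : realDomainType) (x0 c : R) (s : seq R) (i : nat) :
  (i < size s)%N ->
  (c <= nth x0 (sort (fun x y => y <= x) s) i) =
  (i < count (fun x => (c <= x)%R) s)%N.
Proof.
set t := sort _ s => lt_is.
have tot : total (fun x y : R => y <= x) by move=> x y; apply: le_total.
have tr : transitive (fun x y : R => y <= x) by move=> x y z /[swap]; apply: le_trans.
have le_t j l : (j <= l < size t)%N -> nth x0 t l <= nth x0 t j.
  case/andP=> jl lt; have := sorted_leq_nth tr (@lexx _ _) x0 (sort_sorted tot s).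
  by apply; rewrite ?inE // (leq_ltn_trans jl).
have szt : size t = size s by rewrite size_sort.
rewrite -(count_sort (fun x y => y <= x)) -/t -{2}(cat_take_drop i t) count_cat.
have [cle|clt] := leP c (nth x0 t i).
  rewrite (drop_nth x0) ?szt //= cle addnCA addnC addn1 ltnS.
  rewrite (leq_trans _ (leq_addr _ _)) // leq_eqVlt; apply/orP; left.
  have sz_take : size (take i t) = i by rewrite size_takel // szt ltnW.
  rewrite eq_sym -[X in _ == X]sz_take -all_count.
  apply/(all_nthP x0) => j; rewrite sz_take => lt_ji; rewrite nth_take //.
  by apply: (le_trans cle); apply: le_t; rewrite szt lt_is ltnW.
symmetry; apply/negbTE; rewrite -leqNgt.
rewrite [X in (_ + X)%N](_ : _ = 0%N).
  by rewrite addn0 (leq_trans (count_size _ _)) // size_take_min geq_minl.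
apply/eqP; rewrite -leqn0 leqNgt -has_count; apply/hasPn => x /(nthP x0)[j].
rewrite size_drop ltn_subRL szt => lt_ij <-; rewrite nth_drop -ltNge.
by apply: le_lt_trans clt; apply: le_t; rewrite leq_addr szt.
Qed.

(** Both lists contain each [x] as often as its multiplicity [mup x (char_poly M)], which is 0 off
    [rootsR]. *)
Lemma perm_eigenvalues (R : rcfType) (n : nat) (M : 'M[R]_n) (s : seq R) :
  char_poly M = \prod_(x <- s) ('X - x%:P) -> perm_eq (eigenvalues M) s.
Proof.
move=> charM; rewrite /eigenvalues perm_sort; apply/allP => x _ /=; apply/eqP.
have p0 : char_poly M != 0 by rewrite monic_neq0 // char_poly_monic.
rewrite count_flatten -map_comp sumnE big_map.
under eq_bigr do rewrite /= count_nseq /=.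
have -> : count_mem x s = mup x (char_poly M) by rewrite charM mu_prod_XsubC.
have [xr|xr] := boolP (x \in rootsR (char_poly M)).
  rewrite (bigD1_seq x) ?uniq_roots //= eqxx mul1n big1 ?addn0 // => y.
  by move/negbTE->; rewrite mul0n.
rewrite mupNroot; last first.
  by rewrite (roots_onP (roots_on_rootsR p0)) ?in_itv.
rewrite big_seq big1 // => y yr; case: eqVneq => [yx|]; last by rewrite mul0n.
by rewrite yx (negbTE xr) in yr.
Qed.

Lemma char_poly_conj (R : comNzRingType) (n : nat) (P Q D : 'M[R]_n) :
  Q *m P = 1%:M -> char_poly (Q *m D *m P) = char_poly D.
Proof.
move=> QP1; have QP1X : map_mx polyC Q *m map_mx polyC P = 1%:M.
  by rewrite -map_mxM QP1 map_scalar_mx.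
rewrite /char_poly; have -> : char_poly_mx (Q *m D *m P) =
    map_mx polyC Q *m char_poly_mx D *m map_mx polyC P.
  rewrite /char_poly_mx !map_mxM mulmxBr mulmxBl scalar_mxC -(mulmxA _ (map_mx polyC Q)) QP1X.
  by rewrite mulmx1.
by rewrite !det_mulmx mulrAC -det_mulmx QP1X det1 mul1r.
Qed.

(** * Hermitian forms in eigenbases *)

Section Hermitian.

Variables (C : numClosedFieldType) (n : nat).
Implicit Types (M P : 'M[C]_n) (x : 'rV[C]_n).

Lemma unitarymx_dot P x : P \is unitarymx ->
  \sum_i `|(x *m P^t* ) 0 i| ^+ 2 = (x *m x^t* ) 0 0.
Proof.
move=> Pu; transitivity ((x *m P^t* *m (x *m P^t* )^t* ) 0 0).
  by rewrite [RHS]mxE; apply: eq_bigr => i _; rewrite !mxE -normCK.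
rewrite trmx_mul map_mxM trmxCK mulmxA -(mulmxA x) -invmx_unitary //.
by rewrite mulVmx ?unitarymx_unit // mulmx1.
Qed.

(** With [P := spectralmx M] unitary and [M] equal to [P^t* D P], the entries of [x P^t*] are the
    coordinates of [x] in an eigenbasis. *)
Lemma hermitian_form_diag M x : M \is hermsymmx ->
  (x *m M *m x^t* ) 0 0 =
  \sum_i spectral_diag M 0 i * `|(x *m (spectralmx M)^t* ) 0 i| ^+ 2.
Proof.
move=> /hermitian_normalmx/orthomx_spectralP => Meq.
have Pu := spectral_unitarymx M.
set y := x *m (spectralmx M)^t*; set d := spectral_diag M in Meq *.
transitivity ((y *m diag_mx d *m y^t* ) 0 0).
  rewrite /y {1}Meq invmx_unitary // trmx_mul map_mxM trmxCK.
  by rewrite !mulmxA.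
rewrite mxE; apply: eq_bigr => i _.
by rewrite mul_mx_diag !mxE normCK mulrAC mulrC mulrCA mulrA.
Qed.

(* A nonzero vector killed by W, orthogonal to the eigenvectors of M for
   eigenvalues >= c and to those of M' for eigenvalues < c would satisfy
   c |x|^2 <= x M' x^* <= x M x^* < c |x|^2.  Hence these linear conditions
   number at least n. *)
Lemma spectral_count_le (m : nat) (M M' : 'M[C]_n) (W : 'M[C]_(n, m)) (c : C) :
  M \is hermsymmx -> M' \is hermsymmx -> c \is Num.real ->
  (forall x, x *m W = 0 ->
     (x *m M' *m x^t* ) 0 0 <= (x *m M *m x^t* ) 0 0) ->
  (#|[pred i | (c <= spectral_diag M' 0 i)%R]| <=
   #|[pred i | (c <= spectral_diag M 0 i)%R]| + m)%N.
Proof.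
move=> Mh M'h cr le_form; rewrite leqNgt; apply/negP => lt_count.
set S := [pred i | _] in lt_count; set S' := [pred i | _] in lt_count.
have real_sd N i : N \is hermsymmx -> spectral_diag N 0 i \is Num.real.
  by move=> /hermitian_spectral_diag_real/mxOverP.
pose A := row_mx (row_mx (colsub (@enum_val _ S) ((spectralmx M)^t* ))
  (colsub (@enum_val _ [predC S']) ((spectralmx M')^t* ))) W.
have : kermx A != 0.
  (* [A] has [#|S| + #|predC S'| + m] columns, fewer than [n] by [lt_count], so some nonzero row
     vector satisfies all the conditions. *)
  rewrite -mxrank_eq0 mxrank_ker subn_eq0 -ltnNge.
  apply: leq_ltn_trans (rank_leq_col A) _.
  by rewrite addnAC -[ltnRHS]card_ord -(cardC S') ltn_add2r.
move=> /rowV0Pn[x /sub_kermxP xA x0].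
move: xA; rewrite !mul_mx_row -[0 in RHS]hsubmxK => /eq_row_mx[].
rewrite -[lsubmx 0]hsubmxK => /eq_row_mx[xS xS']; rewrite linear0 => xW.
have colsub0 (T : {pred 'I_n}) (B : 'M[C]_n) i : x *m colsub (@enum_val _ T) B = 0 ->
    i \in T -> (x *m B) 0 i = 0.
  move=> /rowP xB iT; have := xB (enum_rank_in iT i).
  rewrite [RHS]mxE => xB0; rewrite -[RHS]xB0 !mxE; apply: eq_bigr => j _.
  by rewrite !mxE enum_rankK_in.
rewrite !linear0 in xS xS'.
have := le_form x xW; apply/negP; rewrite -real_ltNge; first last.
- rewrite hermitian_form_diag //; apply: rpred_sum => i _.
  by rewrite rpredM ?real_sd // ger0_real ?exprn_ge0.
- rewrite hermitian_form_diag //; apply: rpred_sum => i _.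
  by rewrite rpredM ?real_sd // ger0_real ?exprn_ge0.
(* Both forms are compared with [c] times the squared norm of [x], expanded first in the eigenbasis
   of [M'], then in that of [M]. *)
apply: (@lt_le_trans _ _ (c * (x *m x^t* ) 0 0)); last first.
  rewrite -(@unitarymx_dot (spectralmx M')) ?spectral_unitarymx //.
  rewrite hermitian_form_diag // mulr_sumr; apply: ler_sum => i _.
  have [iS'|iS'] := boolP (i \in S'); first by rewrite ler_wpM2r ?exprn_ge0.
  by rewrite (colsub0 _ _ _ xS') // normr0 expr0n !mulr0.
have Pu := spectral_unitarymx M.
rewrite -(unitarymx_dot _ x Pu) hermitian_form_diag // mulr_sumr.
have lt_term i : (x *m (spectralmx M)^t* ) 0 i != 0 ->
    spectral_diag M 0 i * `|(x *m (spectralmx M)^t* ) 0 i| ^+ 2 <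
    c * `|(x *m (spectralmx M)^t* ) 0 i| ^+ 2.
  move=> yi; rewrite ltr_pM2r ?exprn_gt0 ?normr_gt0 // real_ltNge ?real_sd //.
  by apply: contra yi => iS; rewrite (colsub0 _ _ _ xS).
(* One nonzero coordinate is enough to make the inequality between the sums strict. *)
have : x *m (spectralmx M)^t* != 0.
  apply: contra_neq x0 => y0.
  rewrite -[x]mulmx1 -(mulVmx (unitarymx_unit Pu)) invmx_unitary // mulmxA y0.
  by rewrite mul0mx.
move=> /rV0Pn[j yj]; rewrite [ltLHS](bigD1 j) // [ltRHS](bigD1 j) //=.
apply: ltr_leD; first exact: lt_term.
apply: ler_sum => i _; have [->|/lt_term/ltW//] := eqVneq ((x *m (spectralmx M)^t* ) 0 i) 0.
by rewrite normr0 expr0n !mulr0.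
Qed.

End Hermitian.

(** * Real symmetric matrices, through complexification *)

Section Symmetric.

Variables (R : rcfType) (n : nat).
Implicit Types M : 'M[R]_n.

Local Notation toC := (real_complex R).

Lemma map_toC_hermitian M : M^T = M -> map_mx toC M \is hermsymmx.
Proof.
move=> Msym; apply/is_hermitianmxP; rewrite expr0 scale1r map_trmx Msym.
by apply/matrixP => i j; rewrite !mxE; apply/esym/CrealP/complex_realP; exists (M i j).
Qed.

(** Over [R[i]] the characteristic polynomial splits along [spectral_diag], whose entries are real;
    injectivity of [map_poly toC] brings the factorization back to [R]. *)
Lemma perm_eigenvalues_sym M : M^T = M ->
  perm_eq (eigenvalues M)
    [seq complex.Re (spectral_diag (map_mx toC M) 0 i) | i : 'I_n].
Proof.
move=> Msym; apply: perm_eigenvalues.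
have Mh := map_toC_hermitian M Msym.
have /hermitian_normalmx/orthomx_spectralP Meq := Mh.
apply: (map_poly_inj toC); rewrite map_char_poly {1}Meq char_poly_conj; last first.
  by rewrite mulVmx ?spectral_unit.
rewrite char_poly_trig ?diag_mx_is_trig // rmorph_prod /= big_map big_enum /=.
apply: eq_bigr => i _; rewrite map_polyXsubC !mxE eqxx mulr1n.
rewrite /= RRe_real //.
by move/hermitian_spectral_diag_real/mxOverP: Mh.
Qed.

Lemma size_eigenvalues_sym M : M^T = M -> size (eigenvalues M) = n.
Proof.
by move=> /perm_eigenvalues_sym/perm_size->; rewrite size_map size_enum_ord.
Qed.

Lemma ge_lambda M (c : R) (k : nat) : M^T = M -> (1 <= k <= n)%N ->
  (c <= lambda k M) =
  (k <= #|[pred i | (toC c <= spectral_diag (map_mx toC M) 0 i)%R]|)%N.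
Proof.
case: k => // k Msym /= lt_kn; rewrite /lambda /=.
(* Sorting the already sorted list again gives the goal the shape required by [nth_sort_ge]. *)
have -> : eigenvalues M = sort (fun x y => y <= x) (eigenvalues M).
  apply/esym/sorted_sort; last by apply: sort_sorted => x y; apply: le_total.
  by move=> x y z /[swap]; apply: le_trans.
rewrite nth_sort_ge ?size_eigenvalues_sym //; congr (_ <= _)%N.
rewrite (permP (perm_eigenvalues_sym M Msym)) count_map cardE size_filter enumT.
apply: eq_count => i; rewrite /= !inE.
have /hermitian_spectral_diag_real/mxOverP := map_toC_hermitian M Msym.
by move=> /(_ 0 i)/RRe_real {2}<-; rewrite lecR.
Qed.

(** Take [c] to be [lambda (k + m) M']: at least [k + m] eigenvalues of [M'] are [>= c], so
    [spectral_count_le] leaves at least [k] for [M]. *)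
Lemma lambda_le_rank m (M M' : 'M[R]_n) (W : 'M[R[i]]_(n, m)) (k : nat) :
  M^T = M -> M'^T = M' -> (1 <= k)%N -> (k + m <= n)%N ->
  (forall x : 'rV[R[i]]_n, x *m W = 0 ->
     (x *m map_mx toC M' *m x^t* ) 0 0 <= (x *m map_mx toC M *m x^t* ) 0 0) ->
  lambda (k + m) M' <= lambda k M.
Proof.
move=> Ms M's k1 kmn le_form.
have kn : (k <= n)%N := leq_trans (leq_addr m k) kmn.
rewrite ge_lambda ?k1 // -(leq_add2r m).
have cR : toC (lambda (k + m) M') \is Num.real.
  by apply/complex_realP; exists (lambda (k + m) M').
have := spectral_count_le _ _ _ _ _ W _ (map_toC_hermitian M Ms)
  (map_toC_hermitian M' M's) cR le_form.
by apply: leq_trans; rewrite -ge_lambda // kmn addn_gt0 k1.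
Qed.

Lemma lambda_rank1_interlacing M (w : 'cV[R]_n) (k : nat) :
  M^T = M -> (1 <= k <= n.-1)%N ->
  lambda k.+1 (M + w *m w^T) <= lambda k M <= lambda k (M + w *m w^T).
Proof.
move=> Ms /andP[k1 kn].
have kn' : (k < n)%N by case: n k1 kn => [|n'] //; case: k.
have Mws : (M + w *m w^T)^T = M + w *m w^T.
  by rewrite linearD /= trmx_mul trmxK Ms.
have formE (x : 'rV[R[i]]_n) :
    (x *m map_mx toC (M + w *m w^T) *m x^t* ) 0 0 =
    (x *m map_mx toC M *m x^t* ) 0 0 + `|(x *m map_mx toC w) 0 0| ^+ 2.
  rewrite map_mxD map_mxM mulmxDr mulmxDl mxE; congr (_ + _).
  (* [w] is real, so its transpose is its conjugate transpose and the added term is a squared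
     modulus. *)
  have -> : map_mx toC w^T = (map_mx toC w)^t*.
    apply/matrixP => i j; rewrite !mxE; apply/esym/CrealP/complex_realP.
    by exists (w j i).
  rewrite mulmxA -mulmxA -map_mxM -trmx_mul [LHS]mxE big_ord1 !mxE.
  by rewrite normCK.
apply/andP; split.
  (* Here [m = 1]: on the kernel of [w] the two forms coincide. *)
  rewrite -addn1; apply: (lambda_le_rank _ _ _ (map_mx toC w)) => //; first by rewrite addn1.
  by move=> x xw; rewrite formE xw [(0 : 'M_1) 0 0]mxE normr0 expr0n addr0.
(* Here [m = 0]: a matrix with no columns imposes no condition, and the added square is nonnegative
   everywhere. *)
rewrite -[in leLHS](addn0 k).
apply: (lambda_le_rank _ _ _ (0 : 'M_(n, 0))) => // [|x _]; first by rewrite addn0 ltnW.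
by rewrite formE lerDl exprn_ge0.
Qed.

End Symmetric.

(** * The Laplacian under edge deletion *)

Section Laplacian.

Variables (n : nat) (G : oriented_hypergraph n).

Lemma laplacian_sym (R : comPzRingType) : (laplacian R G)^T = laplacian R G.
Proof.
rewrite /laplacian linearB /= tr_diag_mx; congr (_ - _).
apply/matrixP => i j; rewrite !mxE eq_sym; case: eqP => // _.
congr (_%:~R); apply: eq_big => [f|f _]; first by rewrite [(j \in f) && _]andbC.
by rewrite /hsgn !mulNr mulrC.
Qed.

Lemma hdegree_edge_deletion (e : {set 'I_n}) (v : 'I_n) : e \in edges G ->
  hdegree G v = ((v \in e) + hdegree (edge_deletion G e) v)%N.
Proof.
move=> eG; rewrite /hdegree (cardsD1 (v, e)) !inE /= eG eqxx andbT; congr (_ + _)%N.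
apply: eq_card => -[u f]; rewrite !inE xpair_eqE /=.
by case: (eqVneq u v) => [->|]; rewrite ?andbT ?andbF //= andbA.
Qed.

(** The entries outside [e] are set to 0 because [orient] is constrained only on incidences. *)
Definition incidence_col (R : pzRingType) (e : {set 'I_n}) : 'cV[R]_n :=
  \col_i (if i \in e then orient G i e else 0)%:~R.

(** On the diagonal, the square of a sign restores the lost incidence. Off it, for [i] and [j] in
    [e], the product of the signs is [- hsgn G e i j], the lost adjacency term with the sign it has
    in the Laplacian. *)
Lemma laplacian_edge_deletion (R : comPzRingType) (e : {set 'I_n}) :
  e \in edges G ->
  laplacian R G = laplacian R (edge_deletion G e) +
    incidence_col R e *m (incidence_col R e)^T.
Proof.
move=> eG; apply/matrixP => i j; rewrite !mxE big_ord1 !mxE.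
have [<-|ij] := eqVneq i j.
  rewrite !subr0 !mulr1n (hdegree_edge_deletion e) // natrD addrC; congr (_ + _).
  case: ifP => ie; last by rewrite mul0r.
  have /orient_pm1[->|->] : (i, e) \in incidences_of (edges G) by rewrite inE /= eG.
    by rewrite mulr1.
  by rewrite -intrM mulrNN mulr1.
rewrite !mulr0n !sub0r.
rewrite [X in - X%:~R = _](_ : _ = \sum_(f in edges (edge_deletion G e) | (i \in f) && (j \in f))
    hsgn (edge_deletion G e) f i j -
  (if i \in e then orient G i e else 0) * (if j \in e then orient G j e else 0)).
  by rewrite rmorphB opprB /= -intrM addrC.
(* If [e] contains both vertices, its summand is split off; otherwise [e] contributes to neither
   sum. *)
have [ije|ije] := boolP ((i \in e) && (j \in e)).
  rewrite (bigD1 e) /= ?eG // addrC; congr (_ + _).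
    by apply: eq_bigl => f; rewrite !inE -!andbA andbC -!andbA; do !bool_congr.
  by case/andP: ije => -> ->; rewrite /hsgn mulNr.
rewrite [X in _ - X](_ : _ = 0) ?subr0; last first.
  by move: ije; rewrite negb_and; case/orP=> /negbTE->; rewrite ?mul0r ?mulr0.
apply: eq_bigl => f; rewrite !inE; case: eqVneq => // ->.
by rewrite (negbTE ije) !andbF.
Qed.

End Laplacian.

Theorem theorem4p10 (R : realType) (n : nat) (G : oriented_hypergraph n)
    (e : {set 'I_n}) (he : e \in edges G) (k : nat) (hk : (1 <= k <= n.-1)%N) :
  lambda k.+1 (laplacian R G) <= lambda k (laplacian R (edge_deletion G e))
    <= lambda k (laplacian R G).
Proof.
rewrite (laplacian_edge_deletion _ _ _ _ he).
exact: lambda_rank1_interlacing _ _ _ _ _ (laplacian_sym _ _ _) hk.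
Qed.
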